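(* Let $\alpha_0,\dots,\alpha_4$ be complex parameters with $\alpha_0+\alpha_1+2\alpha_2+2\alpha_3+2\alpha_4=1$, and consider the system $$\frac{dx}{dt}=\frac{2x^2y-x^2+(\alpha_0+\alpha_1)x+t}{t}+\frac{2z(zw+\alpha_3)}{t},\qquad \frac{dy}{dt}=\frac{-2xy^2+2xy-(\alpha_0+\alpha_1)y+\alpha_1}{t},$$ $$\frac{dz}{dt}=\frac{2z^2w-z^2+(1-2\alpha_4)z+t}{t}+\frac{2yz^2}{t},\qquad \frac{dw}{dt}=\frac{-2zw^2+2zw-(1-2\alpha_4)w+\alpha_3}{t}-\frac{2y(2zw+\alpha_3)}{t}.$$ This system admits extended affine Weyl group symmetry of type $B_4^{(1)}$ as the group of its Bäcklund transformations, with generators given explicitly as follows. Writing $( * )=(x,y,z,w,t;\alpha_0,\alpha_1,\alpha_2,\alpha_3,\alpha_4)$, set $$s_0:( * )\mapsto\left(x+\tfrac{\alpha_0}{y-1},y,z,w,t;-\alpha_0,\alpha_1,\alpha_2+\alpha_0,\alpha_3,\alpha_4\right),$$ $$s_1:( * )\mapsto\left(x+\tfrac{\alpha_1}{y},y,z,w,t;\alpha_0,-\alpha_1,\alpha_2+\alpha_1,\alpha_3,\alpha_4\right),$$ $$s_2:( * )\mapsto\left(x,y-\tfrac{\alpha_2}{x-z},z,w+\tfrac{\alpha_2}{x-z},t;\alpha_0+\alpha_2,\alpha_1+\alpha_2,-\alpha_2,\alpha_3+\alpha_2,\alpha_4\right),$$ $$s_3:( * )\mapsto\left(x,y,z+\tfrac{\alpha_3}{w},w,t;\alpha_0,\alpha_1,\alpha_2+\alpha_3,-\alpha_3,\alpha_4+\alpha_3\right),$$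 $$s_4:( * )\mapsto\left(x,y,z,w-\tfrac{2\alpha_4}{z}+\tfrac{t}{z^2},-t;\alpha_0,\alpha_1,\alpha_2,\alpha_3+2\alpha_4,-\alpha_4\right),$$ $$\phi:( * )\mapsto(-x,1-y,-z,-w,-t;\alpha_1,\alpha_0,\alpha_2,\alpha_3,\alpha_4).$$ That is: (a) each of $s_0,\dots,s_4,\phi$ is a Bäcklund transformation of the system; (b) they satisfy the defining relations of the extended affine Weyl group of type $B_4^{(1)}$.
   Context: The system is the Hamiltonian system $dx/dt=\partial H/\partial y$, $dy/dt=-\partial H/\partial x$, $dz/dt=\partial H/\partial w$, $dw/dt=-\partial H/\partial z$ with $$tH=x^2y(y-1)+x\{(\alpha_0+\alpha_1)y-\alpha_1\}+ty+z^2w(w-1)+z\{(1-2\alpha_4)w-\alpha_3\}+tw+2yz(zw+\alpha_3).$$ Each transformation is regarded as an automorphism of the field of rational functions in $x,y,z,w,t$ and the parameters (subject to the linear relation on the parameters), given by the images of the generators. A transformation $\sigma$ is a Bäcklund transformation if, whenever $(x(t),y(t),z(t),w(t))$ is a solution of the system with parameters $\alpha_i$ (for which the expressions are defined), the functions $\sigma(x),\sigma(y),\sigma(z),\sigma(w)$, viewed as functions of the new independent variable $\sigma(t)$, solve the same system with parameters $\sigma(\alpha_i)$. The Dynkin diagram of type $B_4^{(1)}$ is labelled here with nodes $0,\dots,4$: simple edges $0$–$2$, $1$–$2$, $2$–$3$, a double edge between $3$ and $4$ (arrow pointing from $3$ to $4$), and no other edges. The relations of the extended affine Weyl group are $s_i^2=1$;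 $(s_is_j)^2=1$ for distinct non-adjacent $i,j$; $(s_is_j)^3=1$ for $i,j$ joined by a simple edge; $(s_3s_4)^4=1$; and, for the diagram automorphism $\phi$ interchanging nodes $0$ and $1$: $\phi^2=1$, $\phi s_0=s_1\phi$, $\phi s_i=s_i\phi$ for $i=2,3,4$. *)

(* Defs.v *)
From HB Require Import structures.
From mathcomp Require Import all_boot all_order all_algebra.
From mathcomp Require Import all_classical all_reals all_analysis.
From mathcomp Require Import complex.
From mathcomp Require Import fraction.
(* The notations of mpoly clash with those of analysis. *)
From mathcomp Require Import -(notations) mpoly.

Set Implicit Arguments.
Unset Strict Implicit.
Unset Printing Implicit Defensive.

Import Order.TTheory GRing.Theory Num.Theory.
Import numFieldNormedType.Exports.
Local Open Scope classical_set_scope.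
Local Open Scope ring_scope.

(* [R[i]] seen as a [numClosedFieldType], so that it carries the norm topology
   and [is_derive _ 1] is the complex derivative. *)
Definition Cplx (R : realType) : numClosedFieldType := R[i].

Section System.
Variable R : realType.
Local Notation C := (Cplx R).

Definition param_rel (A : comNzRingType) (a : 'I_5 -> A) : Prop :=
  a 0 + a 1 + 2 * a 2 + 2 * a 3 + 2 * a 4 = 1.

(* [x], [y], [z], [w] is a holomorphic solution on the open set [D] of the
   system with parameters [a]. *)
Definition is_solution (a : 'I_5 -> C) (D : set C) (x y z w : C -> C) : Prop :=
  [/\ param_rel a, open D &
   forall t : C, D t ->
   [/\ t != 0,
       is_derive t 1 x
         ((2 * x t ^+ 2 * y t - x t ^+ 2 + (a 0 + a 1) * x t + t) / t
          + 2 * z t * (z t * w t + a 3) / t),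
       is_derive t 1 y
         ((- 2 * x t * y t ^+ 2 + 2 * x t * y t - (a 0 + a 1) * y t + a 1) / t),
       is_derive t 1 z
         ((2 * z t ^+ 2 * w t - z t ^+ 2 + (1 - 2 * a 4) * z t + t) / t
          + 2 * y t * z t ^+ 2 / t) &
       is_derive t 1 w
         ((- 2 * z t * w t ^+ 2 + 2 * z t * w t - (1 - 2 * a 4) * w t + a 3) / t
          - 2 * y t * (2 * z t * w t + a 3) / t)]].

(* The relation [param_rel] lets us eliminate alpha_0: the field of rational
   functions is that in the nine independent variables
   x, y, z, w, t, alpha_1, ..., alpha_4, numbered 0, ..., 8. *)
Definition PolRing : idomainType := mpoly 9 C.
Definition RatField : fieldType := {fraction PolRing}.

Definition polyRF (p : PolRing) : RatField := FracField.tofrac p.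
Definition constRF (c : C) : RatField := polyRF (mpolyC 9 c).
Definition varRF (i : 'I_9) : RatField := polyRF (mpolyX C (mnm1 i)).

Definition gen_x : RatField := varRF 0.
Definition gen_y : RatField := varRF 1.
Definition gen_z : RatField := varRF 2.
Definition gen_w : RatField := varRF 3.
Definition gen_t : RatField := varRF 4.
Definition gen_alpha (i : 'I_5) : RatField :=
  [:: 1 - varRF 5 - 2 * varRF 6 - 2 * varRF 7 - 2 * varRF 8;
      varRF 5; varRF 6; varRF 7; varRF 8]`_i.

Definition gens : seq RatField :=
  [:: gen_x; gen_y; gen_z; gen_w; gen_t; 
      gen_alpha 0; gen_alpha 1; gen_alpha 2; gen_alpha 3; gen_alpha 4].

Record rat_aut := RatAut {
  aut_morph :> {rmorphism RatField -> RatField};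
  aut_bij : bijective aut_morph;
  aut_const : forall c : C, aut_morph (constRF c) = constRF c }.

Definition phase_point (a : 'I_5 -> C) (x y z w t : C) : 'I_9 -> C :=
  fun i => [:: x; y; z; w; t; a 1; a 2; a 3; a 4]`_i.

(* [f] is defined at [p], with value [v] there: some way of writing [f] as a
   quotient of polynomials has a denominator that does not vanish at [p]. *)
Definition has_value (f : RatField) (p : 'I_9 -> C) (v : C) : Prop :=
  exists n d : PolRing,
    [/\ f = polyRF n / polyRF d, meval p d != 0 &
        v = meval p n / meval p d].

(* [T] is the new independent variable sigma(t), as a function of the old one
   along the given solution; "viewed as functions of sigma(t)" means that [T] is
   a bijection from [D] onto the new domain [D'], and that the new functions
   composed with [T] are sigma(x), ..., sigma(w) along the given solution. *)
Definition backlund (s : rat_aut) : Prop :=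
  forall (a : 'I_5 -> C) (D : set C) (x y z w : C -> C),
  is_solution a D x y z w ->
  let p t := phase_point a (x t) (y t) (z t) (w t) t in
  (forall t, D t -> forall g, g \in gens -> exists v, has_value (s g) (p t) v) ->
  exists (a' : 'I_5 -> C) (D' : set C) (x' y' z' w' T : C -> C),
  [/\ set_bij D D' T,
      forall t, D t ->
        [/\ has_value (s gen_t) (p t) (T t),
            has_value (s gen_x) (p t) (x' (T t)),
            has_value (s gen_y) (p t) (y' (T t)),
            has_value (s gen_z) (p t) (z' (T t)) &
            has_value (s gen_w) (p t) (w' (T t))],
      forall t, D t -> forall i, has_value (s (gen_alpha i)) (p t) (a' i) &
      is_solution a' D' x' y' z' w'].

End System.

(* Coxeter matrix of type B_4^(1), for the diagram with simple edges
   0-2, 1-2, 2-3 and double edge 3-4. *)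
Definition coxeterB41 (i j : 'I_5) : nat :=
  if i == j then 1%N else
  match minn i j, maxn i j with
  | 0, 2 | 1, 2 | 2, 3 => 3%N
  | 3, 4 => 4%N
  | _, _ => 2%N
  end.

Definition extended_B41_relations (X : Type) (s : 'I_5 -> X -> X)
    (phi : X -> X) : Prop :=
  [/\ forall i j : 'I_5, iter (coxeterB41 i j) (s i \o s j) =1 id,
      phi \o phi =1 id,
      phi \o s 0 =1 s 1 \o phi,
      phi \o s 2 =1 s 2 \o phi &
      phi \o s 3 =1 s 3 \o phi /\ phi \o s 4 =1 s 4 \o phi].

(* Main.v *)
Require Import Defs.
From HB Require Import structures.
From mathcomp Require Import all_boot all_order all_algebra.
From mathcomp Require Import all_classical all_reals all_analysis.
From mathcomp Require Import complex.
From mathcomp Require Import fraction.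
From mathcomp Require Import -(notations) mpoly.
From mathcomp Require Import ring.

Set Implicit Arguments.
Unset Strict Implicit.
Unset Printing Implicit Defensive.

Import Order.TTheory GRing.Theory Num.Theory.
Import numFieldNormedType.Exports.
Local Open Scope ring_scope.

(** Each generator is a birational involution, so the substitution morphism h from
    polynomials to rational functions that it defines is injective: rational
    functions f = n / d with h d <> 0 can be specialized along h, and
    specializing h p again along h gives back p. Hence h extends to an involutive
    automorphism of the field. Automorphisms that fix the constants are determined
    by the images of the generators, so the Coxeter relations reduce to finitely
    many identities of rational functions; those that involve s_1 and a node
    other than 0 follow from the ones for s_0 by conjugation with phi.

    For the Bäcklund property, the transformed expressions can only have a value at
    a point of the solution where the obvious denominator does not vanish. It
    then remains to differentiate them along the solution and to compare with the
    vector field at the transformed point, the new time being e * t with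
    e = 1 or e = -1. *)

(** * Specialization of fractions along a ring morphism *)

Section Specialization.
Variable A : idomainType.

Lemma frac_quot (f : {fraction A}) :
  exists n d : A, d != 0 /\ f = FracField.tofrac n / FracField.tofrac d.
Proof.
elim/quotW: f => r; exists (frac r).1, (frac r).2.
have dn0 := denom_ratioP r; split=> //.
apply: (canRL (mulfK _)); first by rewrite tofrac_eq0.
(* Equality of classes now unfolds to cross-multiplication of representatives. *)
unlock FracField.tofrac; rewrite -[LHS]FracField.pi_mul.
apply/eqmodP; rewrite /= FracField.equivfE /FracField.mulf /=.
rewrite !numden_Ratio ?mulf_neq0 ?oner_eq0 //.
by rewrite !mulr1 mulrC.
Qed.

Variable K : fieldType.
Implicit Types h : {rmorphism A -> K}.

(** A relation, because [h] may kill every available denominator. Evaluation at a point and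
    substitution of fractions for the variables are both instances. *)
Definition specializes h (f : {fraction A}) (v : K) : Prop :=
  exists n d : A,
    [/\ f = FracField.tofrac n / FracField.tofrac d, h d != 0 & v = h n / h d].

Lemma spec_den_neq0 h (d : A) : h d != 0 -> FracField.tofrac d != 0.
Proof.
by apply: contraNneq => /eqP; rewrite tofrac_eq0 => /eqP ->; rewrite rmorph0.
Qed.

Lemma spec_tofrac h (p : A) : specializes h (FracField.tofrac p) (h p).
Proof. by exists p, 1; rewrite !rmorph1 !divr1 oner_eq0. Qed.

(** Equal fractions give a cross-multiplied identity in [A], and [h] carries it to [K]; injectivity
    of [h] is not involved. *)
Lemma spec_uniq h f v v' : specializes h f v -> specializes h f v' -> v = v'.
Proof.
move=> [n [d [-> d0 ->]]] [m [e [/eqP E e0 ->]]]; apply/eqP.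
move: E; rewrite !eqr_div ?(spec_den_neq0 d0) ?(spec_den_neq0 e0) //.
by rewrite -!rmorphM /= tofrac_eq => /eqP ->.
Qed.

Lemma spec_eq h f u v : specializes h f u -> u = v -> specializes h f v.
Proof. by move=> H <-. Qed.

Lemma specD h f g u v :
  specializes h f u -> specializes h g v -> specializes h (f + g) (u + v).
Proof.
move=> [n [d [-> d0 ->]]] [m [e [-> e0 ->]]]; exists (n * e + m * d), (d * e).
split; last 2 first.
- by rewrite rmorphM mulf_neq0.
- by rewrite addf_div // !(rmorphD, rmorphM).
by rewrite addf_div ?(spec_den_neq0 d0) ?(spec_den_neq0 e0) // !(rmorphD, rmorphM).
Qed.

Lemma specM h f g u v :
  specializes h f u -> specializes h g v -> specializes h (f * g) (u * v).
Proof.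
move=> [n [d [-> d0 ->]]] [m [e [-> e0 ->]]]; exists (n * m), (d * e).
by rewrite !rmorphM !mulf_div mulf_neq0.
Qed.

Lemma specN h f u : specializes h f u -> specializes h (- f) (- u).
Proof. by move=> [n [d [-> d0 ->]]]; exists (- n), d; rewrite !rmorphN !mulNr. Qed.

Lemma specB h f g u v :
  specializes h f u -> specializes h g v -> specializes h (f - g) (u - v).
Proof. by move=> Hf Hg; apply: specD => //; apply: specN. Qed.

(** A nonzero value forces [h n != 0], so numerator and denominator may be exchanged. *)
Lemma specV h f u : u != 0 -> specializes h f u -> specializes h f^-1 u^-1.
Proof.
move=> u0 [n [d [-> d0 uE]]]; exists d, n; rewrite uE !invf_div; split=> //.
by apply: contraNneq u0 => n0; rewrite uE n0 mul0r.
Qed.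

Lemma spec0 h : specializes h 0 0.
Proof.
by rewrite -{1}(rmorph0 (@FracField.tofrac A)) -(rmorph0 h); exact: spec_tofrac.
Qed.

Lemma spec1 h : specializes h 1 1.
Proof.
by rewrite -{1}(rmorph1 (@FracField.tofrac A)) -(rmorph1 h); exact: spec_tofrac.
Qed.

Lemma spec_nat h k : specializes h k%:R k%:R.
Proof.
by rewrite -(rmorph_nat (@FracField.tofrac A)) -(rmorph_nat h); exact: spec_tofrac.
Qed.

Lemma spec_exp h f u k : specializes h f u -> specializes h (f ^+ k) (u ^+ k).
Proof.
move=> H; elim: k => [|k IH]; first by rewrite !expr0; apply: spec1.
by rewrite !exprS; apply: specM.
Qed.

(** Serves to certify that a fraction is nonzero by exhibiting one nonzero value, for instance at a
    well-chosen point. *)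
Lemma spec_neq0 h f u : specializes h f u -> u != 0 -> f != 0.
Proof.
move=> [n [d [-> d0 ->]]]; apply: contraNneq => /eqP.
rewrite mulf_eq0 invr_eq0 (negPf (spec_den_neq0 d0)) orbF tofrac_eq0 => /eqP ->.
by rewrite rmorph0 mul0r.
Qed.

(** An iterated conjunction, easy to destruct. Surplus entries of the longer list are ignored; all
    uses have ten entries on both sides. *)
Fixpoint spec_all h (fs : seq {fraction A}) (us : seq K) : Prop :=
  match fs, us with
  | f :: fs', u :: us' => specializes h f u /\ spec_all h fs' us'
  | _, _ => True
  end.

End Specialization.

(** * Automorphisms of the field of rational functions *)

Section FractionExtension.
Variables (A : idomainType) (K : fieldType) (h : {rmorphism A -> K}).
Hypothesis h_inj : injective h.

(** Injectivity keeps every nonzero denominator nonzero. *)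
Let spec_total f : exists v, specializes h f v.
Proof.
have [n [d [d0 ->]]] := frac_quot f; exists (h n / h d); exists n, d; split=> //.
by rewrite -(rmorph0 h) (inj_eq h_inj).
Qed.

Definition frac_ext f : K := projT1 (cid (spec_total f)).

Lemma frac_extP f : specializes h f (frac_ext f).
Proof. exact: (projT2 (cid (spec_total f))). Qed.

Lemma frac_extE f v : specializes h f v -> frac_ext f = v.
Proof. exact: spec_uniq (frac_extP f). Qed.

Fact frac_ext_is_zmod_morphism : zmod_morphism frac_ext.
Proof. by move=> f g; apply/frac_extE/specB; exact: frac_extP. Qed.

Fact frac_ext_is_monoid_morphism : monoid_morphism frac_ext.
Proof.
split=> [|f g]; apply: frac_extE; first exact: spec1.
by apply: specM; exact: frac_extP.
Qed.

HB.instance Definition _ :=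
  GRing.isZmodMorphism.Build {fraction A} K frac_ext frac_ext_is_zmod_morphism.
HB.instance Definition _ :=
  GRing.isMonoidMorphism.Build {fraction A} K frac_ext frac_ext_is_monoid_morphism.

Definition frac_ext_morph : {rmorphism {fraction A} -> K} := frac_ext.

End FractionExtension.

(** * Substitution of fractions for the nine variables *)

Section Substitution.
Variable R : realType.
Local Notation C := (Cplx R).
Local Notation F := (RatField R).
Local Notation P := (PolRing R).

HB.instance Definition _ := GRing.RMorphism.copy (@polyRF R) (@FracField.tofrac P).
HB.instance Definition _ :=
  GRing.RMorphism.copy (@constRF R) (@FracField.tofrac P \o (@mpolyC 9 C)).

Lemma mmap_unique (S : comNzRingType) (h k : {rmorphism P -> S}) :
  (forall c, h (mpolyC 9 c) = k (mpolyC 9 c)) ->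
  (forall i, h (mpolyX C (mnm1 i)) = k (mpolyX C (mnm1 i))) -> h =1 k.
Proof.
move=> hC hX; elim/mpolyind => [|c m p _ _ IH]; first by rewrite !rmorph0.
rewrite !rmorphD IH -mul_mpolyC !rmorphM hC mpolyXE_id !rmorph_prod /=.
congr (_ * _ + _); apply: eq_bigr => i _.
by rewrite !rmorphXn hX.
Qed.

Lemma ratfield_morph_unique (K : fieldType) (f g : {rmorphism F -> K}) :
  (forall c, f (constRF c) = g (constRF c)) ->
  (forall i, f (varRF R i) = g (varRF R i)) -> f =1 g.
Proof.
move=> fC fX q; have [n [d [d0 ->]]] := frac_quot q.
have E : f \o @polyRF R =1 g \o @polyRF R by exact: mmap_unique.
by rewrite !fmorph_div; congr (_ / _); apply: E.
Qed.

Variable im : 'I_9 -> F.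

Definition subst : {rmorphism P -> F} := mmap (@constRF R) im.

Lemma substC c : subst (mpolyC 9 c) = constRF c.
Proof. exact: mmapC. Qed.

Lemma substX i : subst (mpolyX C (mnm1 i)) = im i.
Proof. by rewrite /subst /= mmapX mmap1U. Qed.

(** Substituting and then specializing is a single morphism, determined on the variables. With [h] a
    substitution this gives involutivity; with [h] an evaluation it compares values before and after
    a substitution. *)
Lemma spec_subst (K : fieldType) (h k : {rmorphism P -> K}) :
  (forall c, h (mpolyC 9 c) = k (mpolyC 9 c)) ->
  (forall i, specializes h (im i) (k (mpolyX C (mnm1 i)))) ->
  forall p, specializes h (subst p) (k p).
Proof.
move=> hkC hkX; elim/mpolyind => [|c m p _ _ IH].
  by rewrite !rmorph0; exact: spec0.
rewrite !rmorphD -mul_mpolyC !rmorphM; apply: specD => //; apply: specM.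
  by rewrite substC -hkC; exact: spec_tofrac.
rewrite mpolyXE_id !rmorph_prod /=.
elim/big_ind2: _ => [|f u g v|i _]; [exact: spec1|exact: specM|].
by rewrite !rmorphXn; apply: spec_exp; rewrite substX.
Qed.

Hypothesis invol : forall i, specializes subst (im i) (varRF R i).

Lemma subst_invol p : specializes subst (subst p) (polyRF p).
Proof. by apply: spec_subst => // c; rewrite substC. Qed.

(** If [subst p] is 0, specializing it again along [subst] yields both 0 and [polyRF p], which
    therefore agree. *)
Lemma subst_inj : injective subst.
Proof.
apply: raddf_inj => p p0; have := subst_invol p.
rewrite p0 => H; apply/eqP; rewrite -tofrac_eq0; apply/eqP.
exact: spec_uniq H (spec0 _).
Qed.

Definition subst_ext : {rmorphism F -> F} := frac_ext_morph subst_inj.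

Lemma subst_ext_poly p : subst_ext (polyRF p) = subst p.
Proof. exact/frac_extE/spec_tofrac. Qed.

Lemma subst_ext_const c : subst_ext (constRF c) = constRF c.
Proof. by rewrite subst_ext_poly substC. Qed.

Lemma subst_ext_var i : subst_ext (varRF R i) = im i.
Proof. by rewrite subst_ext_poly substX. Qed.

Lemma subst_extK : involutive subst_ext.
Proof.
apply: (@ratfield_morph_unique F (subst_ext \o subst_ext) idfun) => [c|i] /=.
  by rewrite !subst_ext_const.
by rewrite subst_ext_var; exact/frac_extE.
Qed.

Definition subst_aut : rat_aut R :=
  RatAut (inv_bij subst_extK) subst_ext_const.

End Substitution.

(** * Coxeter relations *)

Section CoxeterIdentities.
Variables (K : fieldType) (s0 s1 s2 s3 s4 phi : {rmorphism K -> K}).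
Variables (x y z w t a0 a1 a2 a3 a4 : K).
Let gs := [:: x; y; z; w; t; a0; a1; a2; a3; a4].
Hypothesis s0E : map s0 gs =
  [:: x + a0 / (y - 1); y; z; w; t; - a0; a1; a2 + a0; a3; a4].
Hypothesis s1E : map s1 gs =
  [:: x + a1 / y; y; z; w; t; a0; - a1; a2 + a1; a3; a4].
Hypothesis s2E : map s2 gs =
  [:: x; y - a2 / (x - z); z; w + a2 / (x - z); t;
      a0 + a2; a1 + a2; - a2; a3 + a2; a4].
Hypothesis s3E : map s3 gs =
  [:: x; y; z + a3 / w; w; t; a0; a1; a2 + a3; - a3; a4 + a3].
Hypothesis s4E : map s4 gs =
  [:: x; y; z; w - 2 * a4 / z + t / z ^+ 2; - t;
      a0; a1; a2; a3 + 2 * a4; - a4].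
Hypothesis phiE : map phi gs =
  [:: - x; 1 - y; - z; - w; - t; a1; a0; a2; a3; a4].
Hypotheses (y1_neq0 : y - 1 != 0) (y_neq0 : y != 0) (xz_neq0 : x - z != 0).
Hypotheses (w_neq0 : w != 0) (z_neq0 : z != 0).

(** Turns a list equation into one multirule for [rewrite]. *)
Let images (f : K -> K) (v0 v1 v2 v3 v4 v5 v6 v7 v8 v9 : K) :
  map f gs = [:: v0; v1; v2; v3; v4; v5; v6; v7; v8; v9] ->
  (f x = v0) * (f y = v1) * (f z = v2) * (f w = v3) * (f t = v4) *
  (f a0 = v5) * (f a1 = v6) * (f a2 = v7) * (f a3 = v8) * (f a4 = v9).
Proof. by case=> *; do !split. Qed.

Let s0R := images s0E.
Let s1R := images s1E.
Let s2R := images s2E.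
Let s3R := images s3E.
Let s4R := images s4E.
Let phiR := images phiE.

Local Ltac calc E F :=
  rewrite /gs /=
    !(E, F, rmorphD, rmorphN, rmorphM, fmorphV, rmorphXn, rmorph_nat, rmorph1);
  do ![congr cons] => //; field;
  rewrite ?y1_neq0 ?y_neq0 ?xz_neq0 ?w_neq0 ?z_neq0 ?andbT //=.

Lemma s01_comm : map (s0 \o s1) gs = map (s1 \o s0) gs.
Proof. by calc s0R s1R. Qed.

Lemma s03_comm : map (s0 \o s3) gs = map (s3 \o s0) gs.
Proof. by calc s0R s3R. Qed.

Lemma s04_comm : map (s0 \o s4) gs = map (s4 \o s0) gs.
Proof. by calc s0R s4R. Qed.

Lemma s24_comm : map (s2 \o s4) gs = map (s4 \o s2) gs.
Proof. by calc s2R s4R. Qed.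

Lemma phi0_conj : map (phi \o s0) gs = map (s1 \o phi) gs.
Proof. by calc (s0R, s1R) phiR; rewrite addrAC subrr sub0r oppr_eq0. Qed.

Lemma phi2_comm : map (phi \o s2) gs = map (s2 \o phi) gs.
Proof. by calc s2R phiR; rewrite -opprD oppr_eq0. Qed.

Lemma phi3_comm : map (phi \o s3) gs = map (s3 \o phi) gs.
Proof. by calc s3R phiR; rewrite oppr_eq0. Qed.

Lemma phi4_comm : map (phi \o s4) gs = map (s4 \o phi) gs.
Proof. by calc s4R phiR; rewrite oppr_eq0. Qed.

(* The denominators left by [field] are images of nonzero elements under
   compositions of the [s_i], up to nonzero factors. *)
Let neq0_prod (e m n : K) : m != 0 -> n != 0 -> e = m * n -> e != 0.
Proof. by move=> m0 n0 ->; rewrite mulf_neq0. Qed.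

Lemma s02_braid : map (s0 \o s2 \o s0) gs = map (s2 \o s0 \o s2) gs.
Proof.
have A0 : (x - z) * (y - 1) - a2 != 0.
  apply: (@neq0_prod _ (s2 (y - 1)) (x - z)); rewrite ?fmorph_eq0 //.
  by rewrite rmorphB rmorph1 !s2R; field.
have B0 : (x - z) * (y - 1) + a0 != 0.
  apply: (@neq0_prod _ (s0 (x - z)) (y - 1)); rewrite ?fmorph_eq0 //.
  by rewrite rmorphB !s0R; field.
(* With the factor 1, [neq0_prod] also covers a denominator that is itself a known nonzero element
   up to [ring]. *)
have one0 := oner_neq0 K.
by calc s0R s2R; apply/and3P; split;
  first [apply: (neq0_prod A0 one0); ring | apply: (neq0_prod B0 one0); ring
       | apply: (neq0_prod A0 y1_neq0); ring | apply: (neq0_prod B0 xz_neq0); ring].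
Qed.

Lemma s23_braid : map (s2 \o s3 \o s2) gs = map (s3 \o s2 \o s3) gs.
Proof.
have P0 : w * (x - z) - a3 != 0.
  apply: (@neq0_prod _ (s3 (x - z)) w); rewrite ?fmorph_eq0 //.
  by rewrite rmorphB !s3R; field.
have Q0 : w * (x - z) + a2 != 0.
  apply: (@neq0_prod _ (s2 w) (x - z)); rewrite ?fmorph_eq0 //.
  by rewrite !s2R; field.
have one0 := oner_neq0 K.
by calc s2R s3R; apply/and3P; split;
  first [apply: (neq0_prod P0 one0); ring | apply: (neq0_prod Q0 one0); ring
       | apply: (neq0_prod P0 xz_neq0); ring | apply: (neq0_prod Q0 w_neq0); ring].
Qed.

Lemma s34_braid :
  map (s3 \o s4 \o s3 \o s4) gs = map (s4 \o s3 \o s4 \o s3) gs.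
Proof.
have W0 : z * w + a3 != 0.
  apply: (@neq0_prod _ (s3 z) w); rewrite ?fmorph_eq0 //.
  by rewrite !s3R; field.
have T0 : (w * z - 2 * a4) * z + t != 0.
  apply: (@neq0_prod _ (s4 w) (z ^+ 2)); rewrite ?fmorph_eq0 ?expf_neq0 //.
  by rewrite !s4R; field.
(* The shift of [a3] by [2 * a4] cancels the term [- 2 * a4] coming from [z * s4 w], so only [t / z]
   is added. *)
have V0 : z * (z * w + a3) + t != 0.
  apply: (@neq0_prod _ (s4 (z * w + a3)) z); rewrite ?fmorph_eq0 //.
  by rewrite rmorphD rmorphM !s4R; field.
set W := z * w + a3 in W0 V0.
have Y0 : w * W ^+ 2 - 2 * (a4 + a3) * w * W + t * w ^+ 2 != 0.
  apply: (@neq0_prod _ (s3 ((w * z - 2 * a4) * z + t)) (w ^+ 2)).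
  - by rewrite fmorph_eq0.
  - by rewrite expf_neq0.
  by rewrite !(rmorphD, rmorphN, rmorphM, rmorph_nat) !s3R /W; field.
set Y := w * W ^+ 2 - _ + _ in Y0.
(* [s4 Y] has denominator [z ^+ 4]; the two spare factors [z] make the product match a condition
   left by [field]. *)
have Z0 : s4 Y * z ^+ 6 != 0 by rewrite mulf_neq0 ?expf_neq0 ?fmorph_eq0.
have sY : s4 Y * z ^+ 6 = ((w * z - 2 * a4) * z + t) * z ^+ 2 *
   ((z * W + t) ^+ 2 - 2 * (a3 + a4) * z * (z * W + t)
    - t * ((w * z - 2 * a4) * z + t)).
  by rewrite !(rmorphD, rmorphN, rmorphM, rmorph_nat, rmorphXn) !s4R /W; field.
have one0 := oner_neq0 K.
have w2 : w ^+ 2 != 0 by rewrite expf_neq0.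
rewrite sY in Z0.
have WV := mulf_neq0 W0 V0.
calc s3R s4R.
  rewrite -/W T0 W0 /=; apply/and3P; split.
  - by apply: (neq0_prod z_neq0 V0); rewrite /W; ring.
  - by apply: (neq0_prod Z0 one0); rewrite /W; ring.
  - by apply: (neq0_prod Y0 one0); rewrite /Y /W; ring.
rewrite -/W T0 W0 /=; apply/and3P; split.
- by apply: (neq0_prod z_neq0 V0); rewrite /W; ring.
- by apply: (neq0_prod Y0 one0); rewrite /Y /W; ring.
- by apply: (neq0_prod w2 WV); rewrite /W; ring.
Qed.
End CoxeterIdentities.

(** * Relations between two involutions *)

Section InvolutionRelations.
Variables (X : Type) (f g : X -> X).
Hypotheses (fK : involutive f) (gK : involutive g).

(** Conjugation by [g] turns [f \o g] into [g \o f], so each unordered pair of nodes needs only one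
    relation. *)
Lemma iter_comp_sym m : iter m (f \o g) =1 id -> iter m (g \o f) =1 id.
Proof.
move=> fgm; have fgE n u : iter n (g \o f) (g u) = g (iter n (f \o g) u).
  by elim: n => //= n ->.
by move=> u; rewrite -[u in LHS]gK fgE fgm gK.
Qed.

(** For involutions, equality of the two alternating words of length [m] makes the [m]-th power of
    the product trivial. Comparing these words halves the length of the compositions to compute; the
    next two lemmas treat [m] equal to 3 and 4. *)
Lemma iter2_comm : f \o g =1 g \o f -> iter 2 (f \o g) =1 id.
Proof. by move=> fg u /=; move: (fg (f (g u))) => /= ->; rewrite fK gK. Qed.

Lemma iter3_braid : f \o g \o f =1 g \o f \o g -> iter 3 (f \o g) =1 id.
Proof. by move=> fg u /=; move: (fg (g (f (g u)))) => /= ->; rewrite gK fK gK. Qed.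

Lemma iter4_braid :
  f \o g \o f \o g =1 g \o f \o g \o f -> iter 4 (f \o g) =1 id.
Proof.
by move=> fg u /=; move: (fg (f (g (f (g u))))) => /= ->; rewrite fK gK fK gK.
Qed.

(** Conjugation by [phi] carries [f \o g] to [f' \o g]; it will transport the relations of node 0 to
    node 1. *)
Lemma iter_comp_conj (phi f' : X -> X) m : involutive phi ->
  phi \o f =1 f' \o phi -> phi \o g =1 g \o phi ->
  iter m (f \o g) =1 id -> iter m (f' \o g) =1 id.
Proof.
move=> phiK pf pg fgm u; rewrite -[u in LHS]phiK.
have E n v : iter n (f' \o g) (phi v) = phi (iter n (f \o g) v).
  elim: n => //= n ->.
  move: (pg (iter n (f \o g) v)) => /= <-.
  by move: (pf (g (iter n (f \o g) v))) => /= <-.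
by rewrite E fgm phiK.
Qed.

End InvolutionRelations.

(** * The six transformations *)

Section Generators.
Variable R : realType.
Local Notation C := (Cplx R).
Local Notation F := (RatField R).
Local Notation P := (PolRing R).

Definition seq5 (A : nmodType) (v0 v1 v2 v3 v4 : A) (i : 'I_5) : A :=
  [:: v0; v1; v2; v3; v4]`_i.

Lemma spec_var (K : fieldType) (h : {rmorphism P -> K}) i :
  specializes h (varRF R i) (h (mpolyX C (mnm1 i))).
Proof. exact: spec_tofrac. Qed.

Lemma gens_eq_morph (K : fieldType) (f g : {rmorphism F -> K}) :
  (forall c, f (constRF c) = g (constRF c)) ->
  map f (gens R) = map g (gens R) -> f =1 g.
Proof.
move=> fC [E0 E1 E2 E3 E4 _ E5 E6 E7 E8]; apply: ratfield_morph_unique => // i.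
(* The bound proof inside [i] is arbitrary; [i] is exchanged for the numeral with the same value, in
   terms of which the equations are stated. *)
suff [j [jE <-]] : exists j : 'I_9, f (varRF R j) = g (varRF R j) /\ j = i by [].
by case: i => -[|[|[|[|[|[|[|[|[|//]]]]]]]]] H;
  [exists 0|exists 1|exists 2|exists 3|exists 4|exists 5|exists 6|exists 7|exists 8];
  (split; [|exact: val_inj]).
Qed.

Lemma param_rel0E (A : comNzRingType) (a : 'I_5 -> A) : param_rel a ->
  a 0 = 1 - a 1 - 2 * a 2 - 2 * a 3 - 2 * a 4.
Proof.
do 4!move/(canRL (addrK _)).
by move=> ->; ring.
Qed.

(** The substitution is fixed by nine images; [param_rel] makes the induced image of [alpha_0] equal
    to [A0]. Quantifying the involution hypothesis over all [h] lets it be checked from the ten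
    values alone. *)
Lemma aut_exists (X Y Z W T A0 A1 A2 A3 A4 : F) :
  let images := [:: X; Y; Z; W; T; A0; A1; A2; A3; A4] in
  param_rel (seq5 A0 A1 A2 A3 A4) ->
  (forall h : {rmorphism P -> F},
     spec_all h (gens R) images -> spec_all h images (gens R)) ->
  exists s : rat_aut R, map s (gens R) = images /\ involutive s.
Proof.
move=> images rel Hinv.
pose im (i : 'I_9) := [:: X; Y; Z; W; T; A1; A2; A3; A4]`_i.
have sv i : specializes (subst im) (varRF R i) (im i).
  exact: spec_eq (spec_var (subst im) i) (substX im i).
have sa0 : specializes (subst im) (gen_alpha R 0) A0.
  apply: spec_eq.
    apply: specB; first apply: specB; first apply: specB; first apply: specB.
    - exact: spec1.
    - exact: (sv 5).
    - apply: specM; [exact: spec_nat|exact: (sv 6)].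
    - apply: specM; [exact: spec_nat|exact: (sv 7)].
    - apply: specM; [exact: spec_nat|exact: (sv 8)].
  by have := param_rel0E rel; rewrite /seq5 /im /= => ->; ring.
have sg : spec_all (subst im) (gens R) images.
  split; first exact: (sv 0).
  split; first exact: (sv 1).
  split; first exact: (sv 2).
  split; first exact: (sv 3).
  split; first exact: (sv 4).
  split; first exact: sa0.
  split; first exact: (sv 5).
  split; first exact: (sv 6).
  split; first exact: (sv 7).
  by split; first exact: (sv 8).
have [v0 [v1 [v2 [v3 [v4 [_ [v5 [v6 [v7 [v8 _]]]]]]]]]] := Hinv _ sg.
have inv i : specializes (subst im) (im i) (varRF R i).
  suff [j [jP <-]] : exists j : 'I_9,
      specializes (subst im) (im j) (varRF R j) /\ j = i by [].
  by case: i => -[|[|[|[|[|[|[|[|[|//]]]]]]]]] H;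
    [exists 0|exists 1|exists 2|exists 3|exists 4|exists 5|exists 6|exists 7|exists 8];
    (split; [|exact: val_inj]).
exists (subst_aut inv); split; last exact: subst_extK.
move: sg => [u0 [u1 [u2 [u3 [u4 [u5 [u6 [u7 [u8 [u9 _]]]]]]]]]].
congr [:: _; _; _; _; _; _; _; _; _; _]; exact: frac_extE.
Qed.

End Generators.

(** The value is an existential variable filled in along the syntax of the fraction, so that only
    nonvanishing conditions remain. *)
Local Ltac specialize_expr :=
  lazymatch goal with
  | |- specializes _ (_ + _) _ => eapply specD; specialize_expr
  | |- specializes _ (- _) _ => eapply specN; specialize_expr
  | |- specializes _ (_ * _) _ => eapply specM; specialize_expr
  | |- specializes _ (_^-1) _ => eapply specV; [|specialize_expr]
  | |- specializes _ (_ ^+ _) _ => eapply spec_exp; specialize_expr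
  | |- specializes _ 1 _ => eapply spec1
  | |- specializes _ (_%:R) _ => eapply spec_nat
  | |- _ => eassumption
  end.

Section SubstitutionValues.
Variables (A : idomainType) (K : fieldType) (h : {rmorphism A -> K}).
Variables (x y z w t a0 a1 a2 a3 a4 : {fraction A}).
Variables (X Y Z W T A0 A1 A2 A3 A4 : K).
Hypothesis hgs : spec_all h [:: x; y; z; w; t; a0; a1; a2; a3; a4]
  [:: X; Y; Z; W; T; A0; A1; A2; A3; A4].

Local Ltac specialize_images :=
  case: hgs => ? [? [? [? [? [? [? [? [? [? _]]]]]]]]];
  do ![split] => //; specialize_expr; rewrite ?expf_neq0.

(** This and the analogues below are applied with [h] the evaluation at a point of a solution: they
    give the transformed point. *)
Lemma s0_values : Y - 1 != 0 -> spec_all h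
    [:: x + a0 / (y - 1); y; z; w; t; - a0; a1; a2 + a0; a3; a4]
    [:: X + A0 / (Y - 1); Y; Z; W; T; - A0; A1; A2 + A0; A3; A4].
Proof. by move=> neq0; specialize_images. Qed.

Lemma s1_values : Y != 0 -> spec_all h
    [:: x + a1 / y; y; z; w; t; a0; - a1; a2 + a1; a3; a4]
    [:: X + A1 / Y; Y; Z; W; T; A0; - A1; A2 + A1; A3; A4].
Proof. by move=> neq0; specialize_images. Qed.

Lemma s2_values : X - Z != 0 -> spec_all h
    [:: x; y - a2 / (x - z); z; w + a2 / (x - z); t;
       a0 + a2; a1 + a2; - a2; a3 + a2; a4]
    [:: X; Y - A2 / (X - Z); Z; W + A2 / (X - Z); T;
       A0 + A2; A1 + A2; - A2; A3 + A2; A4].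
Proof. by move=> neq0; specialize_images. Qed.

Lemma s3_values : W != 0 -> spec_all h
    [:: x; y; z + a3 / w; w; t; a0; a1; a2 + a3; - a3; a4 + a3]
    [:: X; Y; Z + A3 / W; W; T; A0; A1; A2 + A3; - A3; A4 + A3].
Proof. by move=> neq0; specialize_images. Qed.

Lemma s4_values : Z != 0 -> spec_all h
    [:: x; y; z; w - 2 * a4 / z + t / z ^+ 2; - t;
       a0; a1; a2; a3 + 2 * a4; - a4]
    [:: X; Y; Z; W - 2 * A4 / Z + T / Z ^+ 2; - T;
       A0; A1; A2; A3 + 2 * A4; - A4].
Proof. by move=> neq0; specialize_images. Qed.

Lemma phi_values : spec_all h
    [:: - x; 1 - y; - z; - w; - t; a1; a0; a2; a3; a4]
    [:: - X; 1 - Y; - Z; - W; - T; A1; A0; A2; A3; A4].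
Proof. by specialize_images. Qed.

End SubstitutionValues.

(* Over an abstract field [K]: at type [RatField R], [field] would have to compare
   generators by unfolding the construction of the fraction field. *)
Section SubstitutionInverse.
Variables (A : idomainType) (K : fieldType) (h : {rmorphism A -> K}).
Variables (x y z w t a0 a1 a2 a3 a4 : {fraction A}).
Variables (X Y Z W T A0 A1 A2 A3 A4 : K).
Let gs := [:: x; y; z; w; t; a0; a1; a2; a3; a4].
Let GS := [:: X; Y; Z; W; T; A0; A1; A2; A3; A4].

Local Ltac inverse_images :=
  move=> [? [? [? [? [? [? [? [? [? [? _]]]]]]]]]];
  do ![split] => //; (eapply spec_eq; [specialize_expr|]);
  rewrite ?expf_neq0 //; by field.

(** The denominator is fixed while [a0] changes sign, so the second shift undoes the first. The
    shifts in [s1], ..., [s4] are odd in the same way; for [s4] both [a4] and [t] change sign. *)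
Lemma s0_inverse : Y - 1 != 0 ->
  spec_all h gs
    [:: X + A0 / (Y - 1); Y; Z; W; T; - A0; A1; A2 + A0; A3; A4] ->
  spec_all h
    [:: x + a0 / (y - 1); y; z; w; t; - a0; a1; a2 + a0; a3; a4] GS.
Proof. move=> neq0; inverse_images. Qed.

Lemma s1_inverse : Y != 0 ->
  spec_all h gs
    [:: X + A1 / Y; Y; Z; W; T; A0; - A1; A2 + A1; A3; A4] ->
  spec_all h
    [:: x + a1 / y; y; z; w; t; a0; - a1; a2 + a1; a3; a4] GS.
Proof. move=> neq0; inverse_images. Qed.

Lemma s2_inverse : X - Z != 0 ->
  spec_all h gs
    [:: X; Y - A2 / (X - Z); Z; W + A2 / (X - Z); T;
        A0 + A2; A1 + A2; - A2; A3 + A2; A4] ->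
  spec_all h
    [:: x; y - a2 / (x - z); z; w + a2 / (x - z); t;
        a0 + a2; a1 + a2; - a2; a3 + a2; a4] GS.
Proof. move=> neq0; inverse_images. Qed.

Lemma s3_inverse : W != 0 ->
  spec_all h gs
    [:: X; Y; Z + A3 / W; W; T; A0; A1; A2 + A3; - A3; A4 + A3] ->
  spec_all h
    [:: x; y; z + a3 / w; w; t; a0; a1; a2 + a3; - a3; a4 + a3] GS.
Proof. move=> neq0; inverse_images. Qed.

Lemma s4_inverse : Z != 0 ->
  spec_all h gs
    [:: X; Y; Z; W - 2 * A4 / Z + T / Z ^+ 2; - T;
        A0; A1; A2; A3 + 2 * A4; - A4] ->
  spec_all h
    [:: x; y; z; w - 2 * a4 / z + t / z ^+ 2; - t;
        a0; a1; a2; a3 + 2 * a4; - a4] GS.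
Proof. move=> neq0; inverse_images. Qed.

Lemma phi_inverse : spec_all h gs
    [:: - X; 1 - Y; - Z; - W; - T; A1; A0; A2; A3; A4] ->
  spec_all h
    [:: - x; 1 - y; - z; - w; - t; a1; a0; a2; a3; a4] GS.
Proof. inverse_images. Qed.

End SubstitutionInverse.

Section ParameterImages.
Variables (K : fieldType) (a : 'I_5 -> K).
Hypothesis a0E : a 0 = 1 - a 1 - 2 * a 2 - 2 * a 3 - 2 * a 4.

Local Ltac param_rel_image := by rewrite /param_rel /seq5 /= a0E; ring.

(** The coefficients 1, 1, 2, 2, 2 of the relation are those of the null root, which every simple
    reflection fixes. *)
Lemma s0_param :
  param_rel (seq5 (- a 0) (a 1) (a 2 + a 0) (a 3) (a 4)).
Proof. param_rel_image. Qed.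

Lemma s1_param :
  param_rel (seq5 (a 0) (- a 1) (a 2 + a 1) (a 3) (a 4)).
Proof. param_rel_image. Qed.

Lemma s2_param :
  param_rel (seq5 (a 0 + a 2) (a 1 + a 2) (- a 2) (a 3 + a 2) (a 4)).
Proof. param_rel_image. Qed.

Lemma s3_param :
  param_rel (seq5 (a 0) (a 1) (a 2 + a 3) (- a 3) (a 4 + a 3)).
Proof. param_rel_image. Qed.

Lemma s4_param :
  param_rel (seq5 (a 0) (a 1) (a 2) (a 3 + 2 * a 4) (- a 4)).
Proof. param_rel_image. Qed.

Lemma phi_param :
  param_rel (seq5 (a 1) (a 0) (a 2) (a 3) (a 4)).
Proof. param_rel_image. Qed.

End ParameterImages.

Section Transformations.
Variable R : realType.
Local Notation C := (Cplx R).
Local Notation P := (PolRing R).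
Let x := gen_x R.
Let y := gen_y R.
Let z := gen_z R.
Let w := gen_w R.
Let t := gen_t R.
Let a := gen_alpha R.

Lemma gen_alpha0E : a 0 = 1 - a 1 - 2 * a 2 - 2 * a 3 - 2 * a 4.
Proof. by []. Qed.

(** Packaged as a morphism so that [has_value] at [p] is convertible to
    [specializes (eval_at p)]. *)
Definition eval_at (p : 'I_9 -> C) : {rmorphism P -> C} := meval p.

Lemma spec_eval p i : specializes (eval_at p) (varRF R i) (p i).
Proof. by apply: spec_eq (spec_var _ _) _; exact: mevalXU. Qed.

Lemma gen_y_neq0 : y != 0.
Proof. exact: spec_neq0 (spec_eval (fun=> 1) _) (oner_neq0 _). Qed.

Lemma gen_w_neq0 : w != 0.
Proof. exact: spec_neq0 (spec_eval (fun=> 1) _) (oner_neq0 _). Qed.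

Lemma gen_z_neq0 : z != 0.
Proof. exact: spec_neq0 (spec_eval (fun=> 1) _) (oner_neq0 _). Qed.

Lemma gen_y1_neq0 : y - 1 != 0.
Proof.
apply: spec_neq0 (specB (spec_eval (fun=> 0) _) (spec1 _)) _.
by rewrite sub0r oppr_eq0 oner_neq0.
Qed.

Lemma gen_xz_neq0 : x - z != 0.
Proof.
apply: spec_neq0 (specB (spec_eval (fun i => (i == 0)%:R) _) (spec_eval _ _)) _.
by rewrite subr0 oner_neq0.
Qed.

Lemma s0_exists : exists s : rat_aut R, map s (gens R) =
  [:: x + a 0 / (y - 1); y; z; w; t; - a 0; a 1; a 2 + a 0; a 3; a 4] /\
  involutive s.
Proof.
apply: aut_exists => [|h]; first exact: (s0_param gen_alpha0E).
exact: s0_inverse gen_y1_neq0.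
Qed.

Lemma s1_exists : exists s : rat_aut R, map s (gens R) =
  [:: x + a 1 / y; y; z; w; t; a 0; - a 1; a 2 + a 1; a 3; a 4] /\
  involutive s.
Proof.
apply: aut_exists => [|h]; first exact: (s1_param gen_alpha0E).
exact: s1_inverse gen_y_neq0.
Qed.

Lemma s2_exists : exists s : rat_aut R, map s (gens R) =
  [:: x; y - a 2 / (x - z); z; w + a 2 / (x - z); t;
     a 0 + a 2; a 1 + a 2; - a 2; a 3 + a 2; a 4] /\
  involutive s.
Proof.
apply: aut_exists => [|h]; first exact: (s2_param gen_alpha0E).
exact: s2_inverse gen_xz_neq0.
Qed.

Lemma s3_exists : exists s : rat_aut R, map s (gens R) =
  [:: x; y; z + a 3 / w; w; t; a 0; a 1; a 2 + a 3; - a 3; a 4 + a 3] /\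
  involutive s.
Proof.
apply: aut_exists => [|h]; first exact: (s3_param gen_alpha0E).
exact: s3_inverse gen_w_neq0.
Qed.

Lemma s4_exists : exists s : rat_aut R, map s (gens R) =
  [:: x; y; z; w - 2 * a 4 / z + t / z ^+ 2; - t;
     a 0; a 1; a 2; a 3 + 2 * a 4; - a 4] /\
  involutive s.
Proof.
apply: aut_exists => [|h]; first exact: (s4_param gen_alpha0E).
exact: s4_inverse gen_z_neq0.
Qed.

Lemma phi_exists : exists s : rat_aut R, map s (gens R) =
  [:: - x; 1 - y; - z; - w; - t; a 1; a 0; a 2; a 3; a 4] /\
  involutive s.
Proof.
apply: aut_exists => [|h]; first exact: (phi_param gen_alpha0E).
exact: phi_inverse.
Qed.

End Transformations.

(** * Invariance of the vector field *)

Section VectorField.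
Variable K : fieldType.
Implicit Types (a b : 'I_5 -> K) (x y z w t : K).

Definition field_x a x y z w t : K :=
  (2 * x ^+ 2 * y - x ^+ 2 + (a 0 + a 1) * x + t) / t
  + 2 * z * (z * w + a 3) / t.
Definition field_y a x y z w t : K :=
  (- 2 * x * y ^+ 2 + 2 * x * y - (a 0 + a 1) * y + a 1) / t.
Definition field_z a x y z w t : K :=
  (2 * z ^+ 2 * w - z ^+ 2 + (1 - 2 * a 4) * z + t) / t + 2 * y * z ^+ 2 / t.
Definition field_w a x y z w t : K :=
  (- 2 * z * w ^+ 2 + 2 * z * w - (1 - 2 * a 4) * w + a 3) / t
  - 2 * y * (2 * z * w + a 3) / t.

Variables (a : 'I_5 -> K) (x y z w t : K).
Hypothesis t_neq0 : t != 0.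
Hypothesis a0E : a 0 = 1 - a 1 - 2 * a 2 - 2 * a 3 - 2 * a 4.

(* The identities below have the shape in which the derivatives are computed by
   the lemmas [is_derive_pt_*]; the factors 1 and -1 are the derivative of the new
   time. *)
Let dx := field_x a x y z w t.
Let dy := field_y a x y z w t.
Let dz := field_z a x y z w t.
Let dw := field_w a x y z w t.

Local Ltac solve_field :=
  rewrite /dx /dy /dz /dw /field_x /field_y /field_z /field_w /seq5 /= ?a0E;
  field; rewrite ?t_neq0 ?mulN1r ?oppr_eq0 ?oner_neq0 ?t_neq0 //=.

Lemma s0_field (neq0 : y - 1 != 0) :
  let b := seq5 (- a 0) (a 1) (a 2 + a 0) (a 3) (a 4) in
  let X := x + a 0 / (y - 1) in
  [/\ dx + (0 * (y - 1) - a 0 * (dy - 0)) / (y - 1) ^+ 2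
      = 1 * field_x b X y z w (1 * t),
      dy = 1 * field_y b X y z w (1 * t),
      dz = 1 * field_z b X y z w (1 * t) &
      dw = 1 * field_w b X y z w (1 * t)].
Proof. split; solve_field. Qed.

Lemma s1_field (neq0 : y != 0) :
  let b := seq5 (a 0) (- a 1) (a 2 + a 1) (a 3) (a 4) in
  let X := x + a 1 / y in
  [/\ dx + (0 * y - a 1 * dy) / y ^+ 2 = 1 * field_x b X y z w (1 * t),
      dy = 1 * field_y b X y z w (1 * t),
      dz = 1 * field_z b X y z w (1 * t) &
      dw = 1 * field_w b X y z w (1 * t)].
Proof. split; solve_field. Qed.

Lemma s2_field (neq0 : x - z != 0) :
  let b := seq5 (a 0 + a 2) (a 1 + a 2) (- a 2) (a 3 + a 2) (a 4) in
  let Y := y - a 2 / (x - z) in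
  let W := w + a 2 / (x - z) in
  let q := (0 * (x - z) - a 2 * (dx - dz)) / (x - z) ^+ 2 in
  [/\ dx = 1 * field_x b x Y z W (1 * t),
      dy - q = 1 * field_y b x Y z W (1 * t),
      dz = 1 * field_z b x Y z W (1 * t) &
      dw + q = 1 * field_w b x Y z W (1 * t)].
Proof. split; solve_field. Qed.

Lemma s3_field (neq0 : w != 0) :
  let b := seq5 (a 0) (a 1) (a 2 + a 3) (- a 3) (a 4 + a 3) in
  let Z := z + a 3 / w in
  [/\ dx = 1 * field_x b x y Z w (1 * t),
      dy = 1 * field_y b x y Z w (1 * t),
      dz + (0 * w - a 3 * dw) / w ^+ 2 = 1 * field_z b x y Z w (1 * t) &
      dw = 1 * field_w b x y Z w (1 * t)].
Proof. split; solve_field. Qed.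

Lemma s4_field (neq0 : z != 0) :
  let b := seq5 (a 0) (a 1) (a 2) (a 3 + 2 * a 4) (- a 4) in
  let W := w - 2 * a 4 / z + t / z ^+ 2 in
  [/\ dx = -1 * field_x b x y z W (-1 * t),
      dy = -1 * field_y b x y z W (-1 * t),
      dz = -1 * field_z b x y z W (-1 * t) &
      dw - (0 * z - 2 * a 4 * dz) / z ^+ 2
         + (1 * z ^+ 2 - t * (z * dz + z * dz)) / (z ^+ 2) ^+ 2
      = -1 * field_w b x y z W (-1 * t)].
Proof. split; solve_field. Qed.

Lemma phi_field :
  let b := seq5 (a 1) (a 0) (a 2) (a 3) (a 4) in
  [/\ - dx = -1 * field_x b (- x) (1 - y) (- z) (- w) (-1 * t),
      0 - dy = -1 * field_y b (- x) (1 - y) (- z) (- w) (-1 * t),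
      - dz = -1 * field_z b (- x) (1 - y) (- z) (- w) (-1 * t) &
      - dw = -1 * field_w b (- x) (1 - y) (- z) (- w) (-1 * t)].
Proof. split; solve_field. Qed.

End VectorField.

(** * Differentiation rules in one variable *)

Section Derivatives.
Variable K : numFieldType.
Implicit Types (f g : K -> K) (t df dg : K).

(** The rules are stated for functions written pointwise and with products in place of scalings,
    which produces the left-hand sides of [s0_field] and its analogues. *)
Lemma is_derive_ptD f g t df dg : is_derive t 1 f df -> is_derive t 1 g dg ->
  is_derive t 1 (fun u => f u + g u) (df + dg).
Proof. by move=> Hf Hg; exact: is_deriveD. Qed.

Lemma is_derive_ptN f t df : is_derive t 1 f df ->
  is_derive t 1 (fun u => - f u) (- df).
Proof. by move=> Hf; exact: is_deriveN. Qed.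

Lemma is_derive_ptM f g t df dg : is_derive t 1 f df -> is_derive t 1 g dg ->
  is_derive t 1 (fun u => f u * g u) (f t * dg + g t * df).
Proof. by move=> Hf Hg; exact: is_deriveM. Qed.

Lemma is_derive_pt_cst c t : is_derive t 1 ((fun=> c) : K -> K) 0.
Proof. exact: is_derive_cst. Qed.

Lemma is_derive_pt_id t : is_derive t 1 (id : K -> K) 1.
Proof. exact: is_derive_id. Qed.

Lemma is_derive_pt_div f g t df dg :
  is_derive t 1 f df -> is_derive t 1 g dg -> g t != 0 ->
  is_derive t 1 (fun u => f u / g u) ((df * g t - f t * dg) / g t ^+ 2).
Proof.
move=> Hf Hg g0.
have HV : is_derive t 1 (fun u => (g u)^-1) (- (g t) ^- 2 *: dg).
  apply: DeriveDef; first by apply: derivableV => //; exact: ex_derive.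
  by rewrite deriveV ?derive_val //; exact: ex_derive.
apply: is_derive_eq (is_derive_ptM Hf HV) _.
by rewrite /GRing.scale /=; field.
Qed.

(** In one variable derivability is differentiability, so this is the chain rule for differentials,
    followed by linearity of the differential of [f]. *)
Lemma is_derive_comp_mull f (e t d : K) : is_derive (e * t) 1 f d ->
  is_derive t 1 (fun u => f (e * u)) (e * d).
Proof.
move=> [fd <-].
have He : is_derive t 1 ( *%R e : K -> K) e.
  have := is_derive_ptM (is_derive_pt_cst e t) (is_derive_pt_id t).
  by move=> H; apply: is_derive_eq H _; rewrite mulr1 mulr0 addr0.
have hd : differentiable ( *%R e : K -> K) t by apply/derivable1_diffP; case: He.
have fdiff : differentiable f (e * t) by apply/derivable1_diffP.
have cd : differentiable (f \o *%R e) t by apply: differentiable_comp.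
apply: (@DeriveDef _ _ _ _ _ (f \o *%R e)); first by apply/derivable1_diffP.
rewrite deriveE; last exact: cd.
rewrite diff_comp; [|exact: hd|exact: fdiff].
have g1 : 'd ( *%R e : K -> K) t 1 = e.
  exact: etrans (esym (deriveE _ hd)) (@derive_val _ _ _ _ _ _ _ He).
apply: etrans (congr1 ('d f (e * t)) g1) _; rewrite deriveE; last exact: fdiff.
by rewrite -[X in 'd _ _ X]mulr1 linearZ.
Qed.

End Derivatives.

(** * Reduction to derivatives with respect to the old time *)

Section Backlund.
Variable R : realType.
Local Notation C := (Cplx R).

(** As [e] is its own inverse, the functions of the new time are [X \o *%R e] and so on: at [e * t]
    they return [X t]. The chain rule then contributes the factor [e] in front of the vector
    field. *)
Lemma backlund_scaling (s : rat_aut R) (e : C) : e * e = 1 ->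
  (forall (a : 'I_5 -> C) (D : set C) (x y z w : C -> C),
     is_solution a D x y z w ->
     let p t := phase_point a (x t) (y t) (z t) (w t) t in
     (forall t, D t -> forall g, g \in gens R ->
        exists v, has_value (s g) (p t) v) ->
     exists (b : 'I_5 -> C) (X Y Z W : C -> C), param_rel b /\
     forall t, D t ->
       spec_all (eval_at (p t)) (map s (gens R))
         [:: X t; Y t; Z t; W t; e * t; b 0; b 1; b 2; b 3; b 4] /\
       [/\ is_derive t 1 X (e * field_x b (X t) (Y t) (Z t) (W t) (e * t)),
           is_derive t 1 Y (e * field_y b (X t) (Y t) (Z t) (W t) (e * t)),
           is_derive t 1 Z (e * field_z b (X t) (Y t) (Z t) (W t) (e * t)) &
           is_derive t 1 W (e * field_w b (X t) (Y t) (Z t) (W t) (e * t))]) ->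
  backlund s.
Proof.
move=> ee H a D x y z w sol p def.
have [b [X [Y [Z [W [rel Hb]]]]]] := H a D x y z w sol def.
have eK u : e * (e * u) = u by rewrite mulrA ee mul1r.
exists b, ( *%R e @` D)%classic.
exists (X \o *%R e), (Y \o *%R e), (Z \o *%R e), (W \o *%R e), ( *%R e).
have e0 : e != 0.
  by apply/eqP => e0; move/eqP: ee; rewrite e0 mul0r eq_sym oner_eq0.
split.
- split.
  + by move=> u Du; exists u.
  + by move=> u v _ _ /(mulfI e0).
  + by move=> u [v Dv <-]; exists v.
- by move=> t Dt /=; rewrite eK; have [[? [? [? [? [? _]]]]] _] := Hb t Dt.
- move=> t Dt; have [[_ [_ [_ [_ [_ [b0 [b1 [b2 [b3 [b4 _]]]]]]]]]] _] := Hb t Dt.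
  move=> i; suff [j [jP <-]] : exists j : 'I_5,
      has_value (s (gen_alpha R j)) (p t) (b j) /\ j = i by [].
  by case: i => -[|[|[|[|[|//]]]]] i5;
    [exists 0|exists 1|exists 2|exists 3|exists 4]; (split; [|exact: val_inj]).
have [_ Dopen solD] := sol.
split=> //.
  (* The image of [D] is also its preimage under the same continuous map, hence open. *)
  have -> : ( *%R e @` D = *%R e @^-1` D)%classic.
    apply/seteqP; split=> [u [v Dv <-]|u Du] /=; first by rewrite eK.
    by exists (e * u).
  by apply: open_comp => // u _; exact: mulrl_continuous.
move=> u [t Dt <-] /=.
have [t0 _ _ _ _] := solD t Dt.
have [_ [dX dY dZ dW]] := Hb t Dt.
rewrite !eK.
split; first (by rewrite mulf_neq0);
  (* The derivative is written as [e * (e * _)] to expose the outer factor of the chain rule. *)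
  rewrite -[X in is_derive _ _ _ X]eK; apply: is_derive_comp_mull;
  by rewrite eK.
Qed.

End Backlund.

(** * Bäcklund property *)

Lemma addKdivfK (K : fieldType) (c n d : K) : d != 0 -> (c + n / d - c) * d = n.
Proof. by move=> d0; rewrite addrC addKr divfK. Qed.

Section Poles.
Variable R : realType.
Local Notation C := (Cplx R).
Local Notation F := (RatField R).
Local Notation a := (gen_alpha R).

(* If [f] has a value at [p], written with a denominator [e], then [G e != 0], since
   [G] substitutes for the variable [j] a fraction with the same value at [p].
   Then [f] specializes along [G] as well, and so does [n = (f - c) * d], to 0. *)
Lemma pole_not_defined (p : 'I_9 -> C) (j : 'I_9) (q c n d n' c' f : F) (v : C) :
  let G := subst (fun i => if i == j then q else varRF R i) in
  specializes (eval_at p) q (p j) ->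
  specializes G c c' -> specializes G n n' -> specializes G d 0 ->
  d != 0 -> n' != 0 -> f = c + n / d -> ~ has_value f p v.
Proof.
move=> G qp Gc Gn Gd d0 n'0 -> [m [e [E e0 _]]].
have Ge0 : G e != 0.
  apply: spec_neq0 e0; apply: spec_subst => // i.
  case: eqP => [->|_]; rewrite /eval_at /= mevalXU //; exact: spec_eval.
have Gf : specializes G (c + n / d) (G m / G e) by exists m, e.
have Gnd := specM (specB Gf Gc) Gd.
move/eqP: n'0; apply.
apply: spec_uniq Gn _; apply: spec_eq (mulr0 (G m / G e - c')).
by rewrite -[n in specializes _ n](addKdivfK c n d0).
Qed.

Lemma spec_subst_at (j i : 'I_9) (q : F) :
  i != j -> specializes (subst (fun i => if i == j then q else varRF R i))
    (varRF R i) (varRF R i).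
Proof.
by move=> ij; apply: spec_eq (spec_var _ _) _; rewrite substX (negPf ij).
Qed.

Lemma spec_subst_same (j : 'I_9) (q : F) :
  specializes (subst (fun i => if i == j then q else varRF R i)) (varRF R j) q.
Proof. by apply: spec_eq (spec_var _ _) _; rewrite substX eqxx. Qed.

Lemma spec_subst_alpha (j : 'I_9) (q : F) (k : 'I_5) : (j < 5)%N ->
  specializes (subst (fun i => if i == j then q else varRF R i)) (a k) (a k).
Proof.
move=> j5; have hi (i : 'I_9) : (5 <= i)%N -> i != j.
  by move=> i5; apply: contraTneq i5 => ->; rewrite -ltnNge.
case: k => -[|[|[|[|[|//]]]]] k5.
- do 4?apply: specB; first exact: spec1; last 3 first;
    try (apply: specM; first exact: spec_nat); exact/spec_subst_at/hi.
- exact/spec_subst_at/hi.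
- exact/spec_subst_at/hi.
- exact/spec_subst_at/hi.
- exact/spec_subst_at/hi.
Qed.

(** Needed for the numerators at the poles. Parameters are variables here: even where a numerical
    parameter vanishes, the fraction has no value on its polar locus. *)
Lemma gen_alpha_neq0 k : a k != 0.
Proof.
case: k => -[|[|[|[|[|//]]]]] k5; last 4 first.
- exact: spec_neq0 (spec_eval (fun=> 1) _) (oner_neq0 _).
- exact: spec_neq0 (spec_eval (fun=> 1) _) (oner_neq0 _).
- exact: spec_neq0 (spec_eval (fun=> 1) _) (oner_neq0 _).
- exact: spec_neq0 (spec_eval (fun=> 1) _) (oner_neq0 _).
(* At the origin [alpha_0] takes the value 1. *)
have s0 i := spec_eval (fun=> 0 : C) i.
have s2 : specializes (eval_at (fun=> 0 : C)) 2 2 := spec_nat _ 2.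
apply: spec_neq0 (specB (specB (specB (specB (spec1 _) (s0 5))
  (specM s2 (s0 6))) (specM s2 (s0 7))) (specM s2 (s0 8))) _.
by rewrite mulr0 !subr0 oner_neq0.
Qed.

Section Point.
Variables (b : 'I_5 -> C) (x y z w t : C).
Let p := phase_point b x y z w t.

Lemma spec_phase_point : param_rel b ->
  spec_all (eval_at p) (gens R) [:: x; y; z; w; t; b 0; b 1; b 2; b 3; b 4].
Proof.
move=> rel; have sp i : specializes (eval_at p) (varRF R i) (p i) := spec_eval p i.
have s2 : specializes (eval_at p) 2 2 := spec_nat _ 2.
split; first exact: (sp 0).
split; first exact: (sp 1).
split; first exact: (sp 2).
split; first exact: (sp 3).
split; first exact: (sp 4).
split.
  apply: spec_eq (specB (specB (specB (specB (spec1 _) (sp 5))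
    (specM s2 (sp 6))) (specM s2 (sp 7))) (specM s2 (sp 8))) _.
  by rewrite (param_rel0E rel) /p /phase_point /=; ring.
split; first exact: (sp 5).
split; first exact: (sp 6).
split; first exact: (sp 7).
by split; first exact: (sp 8).
Qed.

Local Notation defined f := (exists v, has_value f p v).
Local Notation gx := (gen_x R).
Local Notation gy := (gen_y R).
Local Notation gz := (gen_z R).
Local Notation gw := (gen_w R).
Local Notation gt := (gen_t R).

(** Substituting 1 for [y] kills the denominator but leaves the numerator [a 0] nonzero, so the
    fraction has no value where [y = 1]. *)
Lemma s0_defined : defined (gx + a 0 / (gy - 1)) -> y - 1 != 0.
Proof.
move=> [v fv]; apply/negP; rewrite subr_eq0 => /eqP y1.
apply: (@pole_not_defined p 1 1) fv; last by [].
- by rewrite [p 1]y1; exact: spec1.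
- exact: spec_subst_at.
- exact: spec_subst_alpha.
- by apply: spec_eq (specB (spec_subst_same 1 1) (spec1 _)) _; exact: subrr.
- exact: gen_y1_neq0.
- exact: gen_alpha_neq0.
Qed.

Lemma s1_defined : defined (gx + a 1 / gy) -> y != 0.
Proof.
move=> [v fv]; apply/negP => /eqP y1.
apply: (@pole_not_defined p 1 0) fv; last by [].
- by rewrite [p 1]y1; exact: spec0.
- exact: spec_subst_at.
- exact: spec_subst_alpha.
- exact: spec_subst_same.
- exact: gen_y_neq0.
- exact: gen_alpha_neq0.
Qed.

Lemma s2_defined : defined (gw + a 2 / (gx - gz)) -> x - z != 0.
Proof.
move=> [v fv]; apply/negP; rewrite subr_eq0 => /eqP xz.
(* The polar locus is [x = z], so [x] is replaced by the variable [z] instead of a constant. *)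
apply: (@pole_not_defined p 0 gz) fv; last by [].
- by rewrite [p 0]xz; exact: spec_eval.
- exact: spec_subst_at.
- exact: spec_subst_alpha.
- apply: spec_eq (specB (spec_subst_same 0 gz) (spec_subst_at _ _)) _ => //.
  exact: subrr.
- exact: gen_xz_neq0.
- exact: gen_alpha_neq0.
Qed.

Lemma s3_defined : defined (gz + a 3 / gw) -> w != 0.
Proof.
move=> [v fv]; apply/negP => /eqP w0.
apply: (@pole_not_defined p 3 0) fv; last by [].
- by rewrite [p 3]w0; exact: spec0.
- exact: spec_subst_at.
- exact: spec_subst_alpha.
- exact: spec_subst_same.
- exact: gen_w_neq0.
- exact: gen_alpha_neq0.
Qed.

Lemma gen_t_neq0 : gt != 0.
Proof. exact: spec_neq0 (spec_eval (fun=> 1) _) (oner_neq0 _). Qed.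

(** Brings the simple and the double pole of [s4] over one denominator: at [z = 0] the numerator
    becomes [t], which is a nonzero fraction. *)
Lemma quot_sum (K : fieldType) (c d e f : K) : f != 0 ->
  c - d / f + e / f ^+ 2 = c + (e - d * f) / f ^+ 2.
Proof. by move=> f0; field. Qed.

Lemma s4_defined : defined (gw - 2 * a 4 / gz + gt / gz ^+ 2) -> z != 0.
Proof.
move=> [v fv]; apply/negP => /eqP z0.
apply: (@pole_not_defined p 2 0) fv; last exact/quot_sum/gen_z_neq0.
- by rewrite [p 2]z0; exact: spec0.
- exact: spec_subst_at.
- apply: specB; first exact: spec_subst_at.
  apply: specM; last exact: spec_subst_same.
  by apply: specM; [exact: spec_nat|exact: spec_subst_alpha].
- apply: spec_eq (spec_exp 2 (spec_subst_same 2 0)) _; exact: expr0n.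
- exact: (expf_neq0 2 (gen_z_neq0 R)).
- rewrite (mulr0 (2 * a 4)) (subr0 gt); exact: gen_t_neq0.
Qed.

End Point.
End Poles.

(** * Transformed solutions, one generator at a time *)

Section BacklundTransformations.
Variable R : realType.
Local Notation C := (Cplx R).
Local Notation gx := (gen_x R).
Local Notation gy := (gen_y R).
Local Notation gz := (gen_z R).
Local Notation gw := (gen_w R).
Local Notation gt := (gen_t R).
Local Notation al := (gen_alpha R).

Lemma s0_backlund (s : rat_aut R) : map s (gens R) =
    [:: gx + al 0 / (gy - 1); gy; gz; gw; gt;
      - al 0; al 1; al 2 + al 0; al 3; al 4] -> backlund s.
Proof.
move=> sE; apply: (@backlund_scaling _ _ 1) => [|a D x y z w sol p def].
  by rewrite mulr1.
have [rel _ solD] := sol; have a0E := param_rel0E rel.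
have neq0 t : D t -> y t - 1 != 0.
  move=> Dt; have := def t Dt gx (mem_nth 0 (isT : 0 < size (gens R))%N).
  case: sE => -> *; exact: (@s0_defined _ a (x t) (y t) (z t) (w t) t).
exists (seq5 (- a 0) (a 1) (a 2 + a 0) (a 3) (a 4)).
exists (fun u => x u + a 0 / (y u - 1)), y, z, w; split; first exact: s0_param.
move=> t Dt; split.
  rewrite sE (mul1r t).
  exact: (s0_values (spec_phase_point _ _ _ _ _ rel) (neq0 t Dt)).
have [t0 dx dy dz dw] := solD t Dt.
have [Ex Ey Ez Ew] := @s0_field _ a (x t) (y t) (z t) (w t) t t0 a0E (neq0 t Dt).
have nz := neq0 t Dt.
have dc c := is_derive_pt_cst (c : C) t.
split.
- have dy1 := is_derive_ptD dy (is_derive_ptN (dc 1)).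
  exact: is_derive_eq (is_derive_ptD dx (is_derive_pt_div (dc (a 0)) dy1 nz)) Ex.
- exact: is_derive_eq dy Ey.
- exact: is_derive_eq dz Ez.
- exact: is_derive_eq dw Ew.
Qed.

Lemma s1_backlund (s : rat_aut R) : map s (gens R) =
    [:: gx + al 1 / gy; gy; gz; gw; gt;
      al 0; - al 1; al 2 + al 1; al 3; al 4] -> backlund s.
Proof.
move=> sE; apply: (@backlund_scaling _ _ 1) => [|a D x y z w sol p def].
  by rewrite mulr1.
have [rel _ solD] := sol; have a0E := param_rel0E rel.
have neq0 t : D t -> y t != 0.
  move=> Dt; have := def t Dt gx (mem_nth 0 (isT : 0 < size (gens R))%N).
  case: sE => -> *; exact: (@s1_defined _ a (x t) (y t) (z t) (w t) t).
exists (seq5 (a 0) (- a 1) (a 2 + a 1) (a 3) (a 4)).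
exists (fun u => x u + a 1 / y u), y, z, w; split; first exact: s1_param.
move=> t Dt; split.
  rewrite sE (mul1r t).
  exact: (s1_values (spec_phase_point _ _ _ _ _ rel) (neq0 t Dt)).
have [t0 dx dy dz dw] := solD t Dt.
have [Ex Ey Ez Ew] := @s1_field _ a (x t) (y t) (z t) (w t) t t0 a0E (neq0 t Dt).
have nz := neq0 t Dt.
have dc c := is_derive_pt_cst (c : C) t.
split.
- exact: is_derive_eq (is_derive_ptD dx (is_derive_pt_div (dc (a 1)) dy nz)) Ex.
- exact: is_derive_eq dy Ey.
- exact: is_derive_eq dz Ez.
- exact: is_derive_eq dw Ew.
Qed.

Lemma s2_backlund (s : rat_aut R) : map s (gens R) =
    [:: gx; gy - al 2 / (gx - gz); gz; gw + al 2 / (gx - gz); gt;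
      al 0 + al 2; al 1 + al 2; - al 2; al 3 + al 2; al 4] -> backlund s.
Proof.
move=> sE; apply: (@backlund_scaling _ _ 1) => [|a D x y z w sol p def].
  by rewrite mulr1.
have [rel _ solD] := sol; have a0E := param_rel0E rel.
have neq0 t : D t -> x t - z t != 0.
  (* Both [y] and [w] acquire the pole; the image of [w] already has the form [c + n / d] required
     by [pole_not_defined]. *)
  move=> Dt; have := def t Dt gw (mem_nth 0 (isT : 3 < size (gens R))%N).
  case: sE => _ _ _ -> *; exact: (@s2_defined _ a (x t) (y t) (z t) (w t) t).
exists (seq5 (a 0 + a 2) (a 1 + a 2) (- a 2) (a 3 + a 2) (a 4)).
exists x, (fun u => y u - a 2 / (x u - z u)), z,
  (fun u => w u + a 2 / (x u - z u)); split; first exact: s2_param.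
move=> t Dt; split.
  rewrite sE (mul1r t).
  exact: (s2_values (spec_phase_point _ _ _ _ _ rel) (neq0 t Dt)).
have [t0 dx dy dz dw] := solD t Dt.
have [Ex Ey Ez Ew] := @s2_field _ a (x t) (y t) (z t) (w t) t t0 a0E (neq0 t Dt).
have nz := neq0 t Dt.
have dc c := is_derive_pt_cst (c : C) t.
have dq := is_derive_pt_div (dc (a 2)) (is_derive_ptD dx (is_derive_ptN dz)) nz.
split.
- exact: is_derive_eq dx Ex.
- exact: is_derive_eq (is_derive_ptD dy (is_derive_ptN dq)) Ey.
- exact: is_derive_eq dz Ez.
- exact: is_derive_eq (is_derive_ptD dw dq) Ew.
Qed.

Lemma s3_backlund (s : rat_aut R) : map s (gens R) =
    [:: gx; gy; gz + al 3 / gw; gw; gt;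
      al 0; al 1; al 2 + al 3; - al 3; al 4 + al 3] -> backlund s.
Proof.
move=> sE; apply: (@backlund_scaling _ _ 1) => [|a D x y z w sol p def].
  by rewrite mulr1.
have [rel _ solD] := sol; have a0E := param_rel0E rel.
have neq0 t : D t -> w t != 0.
  move=> Dt; have := def t Dt gz (mem_nth 0 (isT : 2 < size (gens R))%N).
  case: sE => _ _ -> *; exact: (@s3_defined _ a (x t) (y t) (z t) (w t) t).
exists (seq5 (a 0) (a 1) (a 2 + a 3) (- a 3) (a 4 + a 3)).
exists x, y, (fun u => z u + a 3 / w u), w; split; first exact: s3_param.
move=> t Dt; split.
  rewrite sE (mul1r t).
  exact: (s3_values (spec_phase_point _ _ _ _ _ rel) (neq0 t Dt)).
have [t0 dx dy dz dw] := solD t Dt.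
have [Ex Ey Ez Ew] := @s3_field _ a (x t) (y t) (z t) (w t) t t0 a0E (neq0 t Dt).
have nz := neq0 t Dt.
have dc c := is_derive_pt_cst (c : C) t.
split.
- exact: is_derive_eq dx Ex.
- exact: is_derive_eq dy Ey.
- exact: is_derive_eq (is_derive_ptD dz (is_derive_pt_div (dc (a 3)) dw nz)) Ez.
- exact: is_derive_eq dw Ew.
Qed.

Lemma s4_backlund (s : rat_aut R) : map s (gens R) =
    [:: gx; gy; gz; gw - 2 * al 4 / gz + gt / gz ^+ 2; - gt;
      al 0; al 1; al 2; al 3 + 2 * al 4; - al 4] -> backlund s.
Proof.
move=> sE; apply: (@backlund_scaling _ _ (-1)) => [|a D x y z w sol p def].
  by rewrite mulrNN mulr1.
have [rel _ solD] := sol; have a0E := param_rel0E rel.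
have neq0 t : D t -> z t != 0.
  move=> Dt; have := def t Dt gw (mem_nth 0 (isT : 3 < size (gens R))%N).
  case: sE => _ _ _ -> *; exact: (@s4_defined _ a (x t) (y t) (z t) (w t) t).
exists (seq5 (a 0) (a 1) (a 2) (a 3 + 2 * a 4) (- a 4)).
exists x, y, z, (fun u => w u - 2 * a 4 / z u + u / z u ^+ 2).
split; first exact: s4_param.
move=> t Dt; split.
  rewrite sE (mulN1r t).
  exact: (s4_values (spec_phase_point _ _ _ _ _ rel) (neq0 t Dt)).
have [t0 dx dy dz dw] := solD t Dt.
have [Ex Ey Ez Ew] := @s4_field _ a (x t) (y t) (z t) (w t) t t0 a0E (neq0 t Dt).
have nz := neq0 t Dt.
have dc c := is_derive_pt_cst (c : C) t.
split.
- exact: is_derive_eq dx Ex.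
- exact: is_derive_eq dy Ey.
- exact: is_derive_eq dz Ez.
- have d1 := is_derive_ptN (is_derive_pt_div (dc (2 * a 4)) dz nz).
  (* The square is differentiated as the product [z * z], whence [z * dz + z * dz] in [s4_field]. *)
  have d2 := is_derive_pt_div (is_derive_pt_id t) (is_derive_ptM dz dz) (expf_neq0 2 nz).
  exact: is_derive_eq (is_derive_ptD (is_derive_ptD dw d1) d2) Ew.
Qed.

Lemma phi_backlund (s : rat_aut R) : map s (gens R) =
    [:: - gx; 1 - gy; - gz; - gw; - gt;
      al 1; al 0; al 2; al 3; al 4] -> backlund s.
Proof.
move=> sE; apply: (@backlund_scaling _ _ (-1)) => [|a D x y z w sol p def].
  by rewrite mulrNN mulr1.
have [rel _ solD] := sol; have a0E := param_rel0E rel.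
exists (seq5 (a 1) (a 0) (a 2) (a 3) (a 4)).
exists (fun u => - x u), (fun u => 1 - y u), (fun u => - z u), (fun u => - w u).
split; first exact: phi_param.
move=> t Dt; split.
  rewrite sE (mulN1r t).
  exact: (phi_values (spec_phase_point _ _ _ _ _ rel)).
have [t0 dx dy dz dw] := solD t Dt.
have [Ex Ey Ez Ew] := @phi_field _ a (x t) (y t) (z t) (w t) t t0 a0E.
have dc c := is_derive_pt_cst (c : C) t.
split.
- exact: is_derive_eq (is_derive_ptN dx) Ex.
- exact: is_derive_eq (is_derive_ptD (dc 1) (is_derive_ptN dy)) Ey.
- exact: is_derive_eq (is_derive_ptN dz) Ez.
- exact: is_derive_eq (is_derive_ptN dw) Ew.
Qed.

End BacklundTransformations.

(** * Relations as identities of automorphisms *)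

Section Relations.
Variable R : realType.
Local Notation F := (RatField R).

(** A composite is a bare function; presenting it as a list allows an induction that makes it a
    morphism fixing the constants, and such morphisms are determined by the generators. *)
Lemma comp_aut_eq (fs gs : seq (rat_aut R)) :
  let comp hs := foldr (fun (h : rat_aut R) k => h \o k) id hs : F -> F in
  map (comp fs) (gens R) = map (comp gs) (gens R) -> comp fs =1 comp gs.
Proof.
move=> comp.
have comp_morph hs : exists h : {rmorphism F -> F},
    comp hs =1 h /\ forall c, h (constRF c) = constRF c.
  elim: hs => [|f hs [h [hE hC]]]; first by exists idfun.
  by exists (f \o h); split=> [u|c] /=; [rewrite hE|rewrite hC aut_const].
have [f [fE fC]] := comp_morph fs; have [g [gE gC]] := comp_morph gs.
rewrite (eq_map fE) (eq_map gE) => fg u.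
by rewrite fE gE; apply: gens_eq_morph fg u => c; rewrite fC gC.
Qed.

End Relations.

Theorem theorem3p4 (R : realType) :
  let x := gen_x R in let y := gen_y R in let z := gen_z R in let w := gen_w R in
  let t := gen_t R in let a := @gen_alpha R in
  exists (s : 'I_5 -> rat_aut R) (phi : rat_aut R),
  [/\
   [/\ map (s 0) (gens R) =
         [:: x + a 0 / (y - 1); y; z; w; t;
             - a 0; a 1; a 2 + a 0; a 3; a 4],
       map (s 1) (gens R) =
         [:: x + a 1 / y; y; z; w; t;
             a 0; - a 1; a 2 + a 1; a 3; a 4],
       map (s 2) (gens R) =
         [:: x; y - a 2 / (x - z); z; w + a 2 / (x - z); t;
             a 0 + a 2; a 1 + a 2; - a 2; a 3 + a 2; a 4],
       map (s 3) (gens R) =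
         [:: x; y; z + a 3 / w; w; t;
             a 0; a 1; a 2 + a 3; - a 3; a 4 + a 3] &
       map (s 4) (gens R) =
         [:: x; y; z; w - 2 * a 4 / z + t / z ^+ 2; - t;
             a 0; a 1; a 2; a 3 + 2 * a 4; - a 4]],
   map phi (gens R) =
     [:: - x; 1 - y; - z; - w; - t; a 1; a 0; a 2; a 3; a 4],
   (forall i : 'I_5, backlund (s i)) /\ backlund phi &
   extended_B41_relations s phi].
Proof.
move=> x y z w t a.
have [s0 [s0E s0K]] := s0_exists R.
have [s1 [s1E s1K]] := s1_exists R.
have [s2 [s2E s2K]] := s2_exists R.
have [s3 [s3E s3K]] := s3_exists R.
have [s4 [s4E s4K]] := s4_exists R.
have [phi [phiE phiK]] := phi_exists R.
have y0 := gen_y_neq0 R; have y1 := gen_y1_neq0 R; have xz0 := gen_xz_neq0 R.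
have w0 := gen_w_neq0 R; have z0 := gen_z_neq0 R.
have r01 : iter 2 (s0 \o s1) =1 id.
  apply: iter2_comm => //; apply: (@comp_aut_eq _ [:: s0; s1] [:: s1; s0]).
  exact: (s01_comm s0E s1E).
have r03 : iter 2 (s0 \o s3) =1 id.
  apply: iter2_comm => //; apply: (@comp_aut_eq _ [:: s0; s3] [:: s3; s0]).
  exact: (s03_comm s0E s3E).
have r04 : iter 2 (s0 \o s4) =1 id.
  apply: iter2_comm => //; apply: (@comp_aut_eq _ [:: s0; s4] [:: s4; s0]).
  exact: (s04_comm s0E s4E).
have r24 : iter 2 (s2 \o s4) =1 id.
  apply: iter2_comm => //; apply: (@comp_aut_eq _ [:: s2; s4] [:: s4; s2]).
  exact: (s24_comm s2E s4E).
have r02 : iter 3 (s0 \o s2) =1 id.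
  apply: iter3_braid => //.
  apply: (@comp_aut_eq _ [:: s0; s2; s0] [:: s2; s0; s2]).
  exact: (s02_braid s0E s2E).
have r23 : iter 3 (s2 \o s3) =1 id.
  apply: iter3_braid => //.
  apply: (@comp_aut_eq _ [:: s2; s3; s2] [:: s3; s2; s3]).
  exact: (s23_braid s2E s3E).
have r34 : iter 4 (s3 \o s4) =1 id.
  apply: iter4_braid => //.
  apply: (@comp_aut_eq _ [:: s3; s4; s3; s4] [:: s4; s3; s4; s3]).
  exact: (s34_braid s3E s4E).
have p0 : phi \o s0 =1 s1 \o phi.
  apply: (@comp_aut_eq _ [:: phi; s0] [:: s1; phi]).
  exact: (phi0_conj s0E s1E phiE).
have p2 : phi \o s2 =1 s2 \o phi.
  apply: (@comp_aut_eq _ [:: phi; s2] [:: s2; phi]).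
  exact: (phi2_comm s2E phiE).
have p3 : phi \o s3 =1 s3 \o phi.
  apply: (@comp_aut_eq _ [:: phi; s3] [:: s3; phi]).
  exact: (phi3_comm s3E phiE).
have p4 : phi \o s4 =1 s4 \o phi.
  apply: (@comp_aut_eq _ [:: phi; s4] [:: s4; phi]).
  exact: (phi4_comm s4E phiE).
(* As [phi] exchanges nodes 0 and 1 and fixes the others, these come from [r02], [r03] and [r04]. *)
have r12 := iter_comp_conj phiK p0 p2 r02.
have r13 := iter_comp_conj phiK p0 p3 r03.
have r14 := iter_comp_conj phiK p0 p4 r04.
pose s (i : 'I_5) := nth s0 [:: s0; s1; s2; s3; s4] i.
have sK i : involutive (s i) by case: i => -[|[|[|[|[|//]]]]].
exists s, phi; split=> //.
- split; last exact: (phi_backlund phiE).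
  case=> -[|[|[|[|[|//]]]]] i5.
  + exact: (s0_backlund s0E).
  + exact: (s1_backlund s1E).
  + exact: (s2_backlund s2E).
  + exact: (s3_backlund s3E).
  + exact: (s4_backlund s4E).
- split=> //.
  (* The ten pairs with [i < j] are the relations above; pairs with [j < i] follow by symmetry of
     the Coxeter matrix, and the diagonal from involutivity. *)
  have rel_lt (i j : 'I_5) : (i < j)%N -> iter (coxeterB41 i j) (s i \o s j) =1 id.
    by case: i j => -[|[|[|[|[|//]]]]] i5 [[|[|[|[|[|//]]]]] j5].
  move=> i j; case: (ltngtP i j) => [|ji|/val_inj ->]; first exact: rel_lt.
  + have -> : coxeterB41 i j = coxeterB41 j i.
      by rewrite /coxeterB41 eq_sym minnC maxnC.
    exact/iter_comp_sym/rel_lt.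
  + by rewrite /coxeterB41 eqxx => u /=; exact: sK.
Qed.
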